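(* Let $\mathcal{X}$ be a Banach space, $V$ a finite dimensional subspace of $\mathcal{X}$, $\varepsilon>0$, let $M:\mathcal{X}\to\mathbb{R}^m$ be a measurement operator with null space $\mathcal{N}\ne\{0\}$ such that $\mathcal{N}\cap V=\{0\}$, and let $\mathcal{K}=\mathcal{K}(\varepsilon,V)$. Let $\Delta:\mathbb{R}^m\to\mathcal{X}$ be any lifting (of finite norm $\|\Delta\|$), let $\Lambda:\mathbb{R}^m\to Z:=M(V)$ be any near best approximation map with constant $\lambda\ge1$, and define $A:\mathbb{R}^m\to\mathcal{X}$ by $$A(w):=M_V^{-1}(\Lambda(w))+\Delta(w-\Lambda(w)),\qquad w\in\mathbb{R}^m .$$ Then: (i) $A(w)\in\mathcal{X}_w$ for all $w\in\mathbb{R}^m$. (ii) $\operatorname{dist}(A(M(x)),V)_{\mathcal{X}}\le\lambda\|\Delta\|\operatorname{dist}(x,V)_{\mathcal{X}}$ for all $x\in\mathcal{X}$. (iii) If $\|\Delta\|=1$ and $\lambda=1$, then $A(M(x))\in\mathcal{K}_w$ whenever $x\in\mathcal{K}_w$. (iv) If $\|\Delta\|=1$ and $\lambda=1$, then $A$ is near optimal with constant $2$, i.e. for any $w\in\mathbb{R}^m$, $$\sup_{x\in\mathcal{K}_w}\|x-A(M(x))\|\le 2\operatorname{rad}(\mathcal{K}_w).$$ (v) If $\|\Delta\|=1$ and $\lambda=1$, then $A$ is also near optimal in the sense of minimizing $R(\mathcal{K})$, namely $$\sup_{w\in\mathbb{R}^m}\sup_{x\in\mathcal{K}_w}\|x-A(M(x))\|\le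 2R(\mathcal{K}).$$ (vi) If $\|\Delta\|=1$ and $\lambda=1$, then $$\sup_{w\in\mathbb{R}^m}\sup_{x\in\mathcal{K}_w}\|x-A(M(x))\|\le 4\varepsilon\,\mu(\mathcal{N},V).$$
   Context: All Banach spaces are real. A measurement operator is a map $M:\mathcal{X}\to\mathbb{R}^m$, $M(f)=(l_1(f),\dots,l_m(f))$, where $l_1,\dots,l_m\in\mathcal{X}^*$ are linearly independent; its null space is $\mathcal{N}=\ker M$. For $w\in\mathbb{R}^m$, $\mathcal{X}_w:=\{f\in\mathcal{X}:M(f)=w\}$, and for $S\subset\mathcal{X}$, $S_w:=S\cap\mathcal{X}_w$. The norm $\|\cdot\|_M$ on $\mathbb{R}^m$ is $\|w\|_M:=\inf_{x\in\mathcal{X}_w}\|x\|$. The approximation set is $\mathcal{K}(\varepsilon,V)=\{f\in\mathcal{X}:\operatorname{dist}(f,V)_{\mathcal{X}}\le\varepsilon\}$. $M_V$ denotes the restriction of $M$ to $V$; since $\mathcal{N}\cap V=\{0\}$ it is a linear bijection from $V$ onto $Z=M(V)\subset\mathbb{R}^m$, with inverse $M_V^{-1}:Z\to V$. A lifting is a (possibly nonlinear) map $\Delta:\mathbb{R}^m\to\mathcal{X}$ with $\Delta(w)\in\mathcal{X}_w$ for all $w$; its norm $\|\Delta\|$ is the smallest constant $C$ with $\|\Delta(w)\|_{\mathcal{X}}\le C\|w\|_M$ for all $w\in\mathbb{R}^m$. A map $\Lambda:\mathbb{R}^m\to Z$ is near best with constant $\lambda\ge1$ if $\|w-\Lambda(w)\|_M\le\lambda\inf_{z\in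 Z}\|w-z\|_M$ for all $w\in\mathbb{R}^m$. The Chebyshev radius is $\operatorname{rad}(S):=\inf_{a\in\mathcal{X}}\sup_{f\in S}\|f-a\|$, and $R(S):=\sup_{w\in\mathbb{R}^m}\operatorname{rad}(S_w)$; suprema and radii over the empty set are taken to be $0$. For subspaces $X\ne\{0\}$ and $Y$ of $\mathcal{X}$, $\mu(X,Y):=\sup_{x\in X\setminus\{0\}}\frac{\|x\|}{\operatorname{dist}(x,Y)}=\sup_{x\in X\setminus\{0\},\,y\in Y}\frac{\|x\|}{\|x-y\|}$. *)

(* Defs.v *)
From mathcomp Require Import all_boot all_order all_algebra.
From mathcomp Require Import all_classical all_reals all_analysis.

Set Implicit Arguments.
Unset Strict Implicit.
Unset Printing Implicit Defensive.

Import Order.TTheory GRing.Theory Num.Theory.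
Import numFieldNormedType.Exports.

Local Open Scope classical_set_scope.
Local Open Scope ring_scope.

(** Supremum of a nonnegative quantity, in [0, +oo]; its value on the empty
    set is 0, whereas [ereal_sup set0 = -oo]. *)
Definition nnsup (R : realType) (T : Type) (S : set T) (F : T -> \bar R) :
    \bar R :=
  maxe 0%E (ereal_sup [set F x | x in S]).

Section Space.
Variables (R : realType) (X : completeNormedModType R).
Implicit Types (S V Y : set X) (f a x : X).

(** Linear span of a finite, not necessarily free, family. *)
Definition findim_subspace V : Prop :=
  exists (n : nat) (e : 'I_n -> X),
    V = [set \sum_(i < n) c i *: e i | c in [set: 'I_n -> R]].

Definition dist f V : R := inf [set `|f - v| | v in V].

Definition approx_set (eps : R) V : set X := [set f | dist f V <= eps].

Definition chebyshev_rad S : \bar R :=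
  ereal_inf [set nnsup S (fun f => `|f - a|%:E) | a in [set: X]].

(** In [\bar R], [r%:E / 0 = +oo] for [r > 0], which is the value wanted at a
    nonzero [x] with [dist x Y = 0]. *)
Definition mu_angle S Y : \bar R :=
  nnsup (S `\ 0) (fun x => `|x|%:E / (dist x Y)%:E)%E.

Section Measurements.
Variable m : nat.
Implicit Types (M : X -> 'rV[R]_m) (w : 'rV[R]_m).

Definition measurement_operator M : Prop :=
  exists l : 'I_m -> {scalar X},
    [/\ forall i, continuous (l i : X -> R),
        forall c : 'I_m -> R,
          (forall f, \sum_(i < m) c i * l i f = 0) -> forall i, c i = 0
      & forall f, M f = \row_(i < m) l i f].

Definition null_space M : set X := [set f | M f = 0].

(** [slice M S w] is S_w; in particular [slice M setT w] is X_w. *)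
Definition slice M S w : set X := S `&` [set f | M f = w].

Definition normM M w : R := inf [set `|x| | x in slice M [set: X] w].

Definition sup_rad M S : \bar R :=
  nnsup [set: 'rV[R]_m] (fun w => chebyshev_rad (slice M S w)).

Definition lifting M (Delta : 'rV[R]_m -> X) : Prop :=
  forall w, slice M [set: X] w (Delta w).

Definition lifting_bounds M (Delta : 'rV[R]_m -> X) : set R :=
  [set C | 0 <= C /\ forall w, `|Delta w| <= C * normM M w].

(** The real [inf] is the smallest bound only when [lifting_bounds M Delta] is
    nonempty, i.e. when [Delta] has finite norm. *)
Definition lifting_norm M (Delta : 'rV[R]_m -> X) : R :=
  inf (lifting_bounds M Delta).

Definition near_best M (Z : set 'rV[R]_m) (lam : R)
    (Lambda : 'rV[R]_m -> 'rV[R]_m) : Prop :=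
  forall w, Z (Lambda w) /\
    normM M (w - Lambda w) <= lam * inf [set normM M (w - z) | z in Z].

(** ['pinv_ d V M] is the inverse of the restriction of [M] to [V] on
    [M @` V]; outside of [M @` V] its value is irrelevant, since [Lambda] is
    meant to take its values in [M @` V]. *)
Definition reconstruction M V (Delta : 'rV[R]_m -> X)
    (Lambda : 'rV[R]_m -> 'rV[R]_m) (w : 'rV[R]_m) : X :=
  'pinv_(fun=> 0) V M (Lambda w) + Delta (w - Lambda w).

Definition slice_error M S (A : 'rV[R]_m -> X) w : \bar R :=
  nnsup (slice M S w) (fun x => `|x - A (M x)|%:E).

End Measurements.
End Space.

(* Main.v *)
Require Import Defs.
From mathcomp Require Import all_boot all_order all_algebra.
From mathcomp Require Import all_classical all_reals all_analysis.

Set Implicit Arguments.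
Unset Strict Implicit.
Unset Printing Implicit Defensive.

Import Order.TTheory GRing.Theory Num.Theory.
Import numFieldNormedType.Exports.

Local Open Scope classical_set_scope.
Local Open Scope ring_scope.

(** Since [A (M x)] differs from the element [M_V^-1 (Lambda (M x))] of [V] by
    [Delta (M x - Lambda (M x))], its distance to [V] is at most
    [||Delta|| * ||M x - Lambda (M x)||_M], which near optimality of [Lambda]
    bounds by [lam * ||Delta||] times the [M]-distance of [M x] to [M V].  As
    [M] does not increase norms when its target carries [||.||_M], that
    [M]-distance is at most [dist x V].  This is [dist_reconstruction].

    When [||Delta|| = lam = 1], the map [A] therefore sends every slice of [K]
    into itself, and the remaining estimates depend on [A] only through this
    property.
    If [x] and [A (M x)] both lie in a slice [K_w], any ball containing [K_w]
    contains both, so that their distance is at most its diameter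
    ([slice_error_le_rad]).  Moreover [x - A (M x)] is in the null space of [M]
    and is within [2 * eps] of [V], because each of the two points is within
    [eps] of [V]; by definition of [mu] its norm is then at most
    [2 * eps * mu] ([slice_error_le_mu_angle]). *)

(** * Infima and suprema of images *)

Section Extrema.
Variables (R : realType) (T : Type).
Implicit Types (S : set T) (F : T -> R) (G : T -> \bar R).

Lemma inf_image_le S F x :
  (forall y, 0 <= F y) -> S x -> inf [set F y | y in S] <= F x.
Proof.
move=> F0 Sx; apply: ge_inf; last by exists x.
by exists 0 => _ [y _ <-].
Qed.

Lemma le_inf_image S F c :
  S !=set0 -> (forall y, S y -> c <= F y) -> c <= inf [set F y | y in S].
Proof.
move=> [x Sx] cF; apply: lb_le_inf; first by exists (F x), x.
by move=> _ [y Sy <-]; exact: cF.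
Qed.

Lemma inf_image_ge0 S F :
  (forall y, 0 <= F y) -> 0 <= inf [set F y | y in S].
Proof.
move=> F0; have [->|/set0P S0] := eqVneq S set0; last exact: le_inf_image.
by rewrite image_set0 inf0.
Qed.

Lemma nnsup_ge0 S G : (0 <= nnsup S G)%E.
Proof. by rewrite /nnsup le_max lexx. Qed.

Lemma le_nnsup S G x : S x -> (G x <= nnsup S G)%E.
Proof.
move=> Sx; rewrite /nnsup le_max; apply/orP; right.
by apply: ereal_sup_ubound; exists x.
Qed.

Lemma nnsup_le S G c :
  (0 <= c)%E -> (forall x, S x -> (G x <= c)%E) -> (nnsup S G <= c)%E.
Proof.
move=> c0 Gc; rewrite /nnsup ge_max c0 /=.
by apply: ge_ereal_sup => _ [x Sx <-]; exact: Gc.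
Qed.

End Extrema.

(** * Distance to a subspace *)

Section Distance.
Variables (R : realType) (X : completeNormedModType R).
Implicit Types (S V Y : set X) (f g v x : X).

Lemma findim_subspace0 V : findim_subspace V -> V 0.
Proof.
move=> [n [e ->]]; exists (fun=> 0) => //.
by rewrite big1 // => i _; rewrite scale0r.
Qed.

Lemma findim_subspaceB V : findim_subspace V ->
  forall u v, V u -> V v -> V (u - v).
Proof.
move=> [n [e ->]] _ _ [a _ <-] [b _ <-]; exists (fun i => a i - b i) => //.
by rewrite -sumrB; apply: eq_bigr => i _; rewrite scalerBl.
Qed.

Lemma dist_ge0 f V : 0 <= dist f V.
Proof. by apply: inf_image_ge0 => v; exact: normr_ge0. Qed.

Lemma dist_le f V v : V v -> dist f V <= `|f - v|.
Proof. by apply: (@inf_image_le _ _ V (fun u => `|f - u|)). Qed.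

Lemma distB_le V f g : V !=set0 -> (forall u v, V u -> V v -> V (u - v)) ->
  dist (f - g) V <= dist f V + dist g V.
Proof.
move=> V0 VB; rewrite -lerBlDr; apply: le_inf_image => // u Vu.
rewrite lerBlDr -lerBlDl; apply: le_inf_image => // v Vv.
rewrite lerBlDl (le_trans (dist_le _ (VB _ _ Vu Vv)))//.
by rewrite opprD addrACA -opprD ler_normB.
Qed.

(** The bound involves [d > 0] rather than [dist x Y] itself: when [x] is
    nonzero and [dist x Y = 0], the angle is infinite, while the product
    [0 * +oo] is [0]. *)
Lemma norm_le_mu_angle S Y x (d : R) :
  0 < d -> S x -> dist x Y <= d -> (`|x|%:E <= d%:E * mu_angle S Y)%E.
Proof.
move=> d0 Sx xd; have [->|x0] := eqVneq x 0.
  by rewrite normr0 mule_ge0 ?lee_fin ?(ltW d0)//; exact: nnsup_ge0.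
rewrite -lee_pdivrMl// muleC.
apply: (@le_trans _ _ (`|x|%:E / (dist x Y)%:E)%E); last first.
  apply: (le_nnsup (fun y => `|y|%:E / (dist y Y)%:E)%E).
  by split => //; exact/eqP.
rewrite lee_wpmul2l ?lee_fin//.
have -> : (d^-1)%:E = (d%:E^-1)%E by rewrite inver gt_eqF.
by rewrite lee_pV2 ?inE ?lee_fin ?dist_ge0 ?(ltW d0).
Qed.

End Distance.

(** * Measurements and liftings *)

Section Measurements.
Variables (R : realType) (X : completeNormedModType R) (m : nat).
Variable M : X -> 'rV[R]_m.
Implicit Types (S V : set X) (A Delta : 'rV[R]_m -> X) (w : 'rV[R]_m).

Lemma measurement_operatorB :
  measurement_operator M -> {morph M : x y / x - y}.
Proof.
by move=> [l [_ _ Ml]] x y; apply/rowP => i; rewrite !Ml !mxE raddfB.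
Qed.

Lemma normM_ge0 w : 0 <= normM M w.
Proof. by apply: inf_image_ge0 => x; exact: normr_ge0. Qed.

Lemma normM_le x : normM M (M x) <= `|x|.
Proof. by apply: (@inf_image_le _ _ _ (fun y : X => `|y|)). Qed.

(** The bounds of [Delta] form a closed set, so that a nonempty set of bounds
    contains its infimum. *)
Lemma lifting_norm_bound Delta w : lifting_bounds M Delta !=set0 ->
  `|Delta w| <= lifting_norm M Delta * normM M w.
Proof.
move=> Delta_fin; have := normM_ge0 w; rewrite le_eqVlt => /predU1P[w0|w0].
  by case: Delta_fin => C [_ /(_ w)]; rewrite -w0 !mulr0.
rewrite -ler_pdivrMr//; apply: lb_le_inf => // C [_ /(_ w)].
by rewrite ler_pdivrMr.
Qed.

Section Reconstruction.
Hypothesis MB : {morph M : x y / x - y}.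
Variables (V : set X) (Delta : 'rV[R]_m -> X).
Variables (lam : R) (Lambda : 'rV[R]_m -> 'rV[R]_m).
Hypothesis hLambda : near_best M (M @` V) lam Lambda.

Lemma reconstruction_slice w :
  lifting M Delta -> M (reconstruction M V Delta Lambda w) = w.
Proof.
move=> hDelta; rewrite /reconstruction -[X in _ + X]opprK MB.
have [ZL _] := hLambda w.
rewrite pinvK ?inE// -[- Delta _]sub0r MB (hDelta _).2.
have -> : M 0 = 0 by rewrite -(subrr 0) MB subrr.
by rewrite sub0r opprK addrC subrK.
Qed.

(** Each [v] in [V] gives the competitor [M v] in [M V], and [M (x - v)] has
    [M]-norm at most [|x - v|]. *)
Lemma near_best_le_dist x : V !=set0 -> 0 <= lam ->
  normM M (M x - Lambda (M x)) <= lam * dist x V.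
Proof.
move=> V0 lam0; apply: le_trans (hLambda (M x)).2 _.
rewrite ler_wpM2l//; apply: le_inf_image => // v Vv.
apply: (le_trans _ (normM_le (x - v))); rewrite MB.
apply: (@inf_image_le _ _ _ (fun z => normM M (M x - z))); last by exists v.
by move=> z; exact: normM_ge0.
Qed.

Lemma dist_reconstruction x :
  V !=set0 -> 0 <= lam -> lifting_bounds M Delta !=set0 ->
  dist (reconstruction M V Delta Lambda (M x)) V
    <= lam * lifting_norm M Delta * dist x V.
Proof.
move=> V0 lam0 Delta_fin; rewrite /reconstruction.
have VL : V ('pinv_(fun=> 0) V M (Lambda (M x))).
  apply: (@surjpinv_image_sub _ _ _ V (M @` V) M); first by [].
  by exists (Lambda (M x)) => //; exact: (hLambda _).1.
apply: le_trans (dist_le _ VL) _; rewrite addrC addKr.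
apply: le_trans (lifting_norm_bound _ Delta_fin) _.
rewrite (mulrC lam) -mulrA; apply: ler_wpM2l; last exact: near_best_le_dist.
by apply: lb_le_inf => // C [].
Qed.

End Reconstruction.

(** * Maps that preserve the slices of a set *)

(** Both [x] and [A (M x)] are compared with an arbitrary center [a], which
    gives the factor [2] between diameter and radius. *)
Lemma slice_error_le_rad S A w :
  (forall w x, slice M S w x -> slice M S w (A (M x))) ->
  (slice_error M S A w <= 2%:E * chebyshev_rad (slice M S w))%E.
Proof.
move=> AS; rewrite -lee_pdivrMl//; apply: le_ereal_inf_tmp => _ [a _ <-].
rewrite lee_pdivrMl//; apply: nnsup_le.
  by rewrite mule_ge0 ?lee_fin//; exact: nnsup_ge0.
move=> x Sx; rewrite mule_natl mule2n.
apply: (@le_trans _ _ (`|x - a|%:E + `|A (M x) - a|%:E)%E).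
  by rewrite -EFinD lee_fin -[`|A _ - a|]distrC ler_distD.
by apply: leeD; apply: (le_nnsup (fun f => `|f - a|%:E)) => //; exact: AS.
Qed.

(** The error [x - A (M x)] lies in the null space of [M], and within
    [2 * eps] of [V] as a difference of two points within [eps] of [V]. *)
Lemma slice_error_le_mu_angle (V : set X) (eps : R) A w :
  {morph M : x y / x - y} ->
  V !=set0 -> (forall u v, V u -> V v -> V (u - v)) -> 0 < eps ->
  (forall w x, slice M (approx_set eps V) w x ->
     slice M (approx_set eps V) w (A (M x))) ->
  (slice_error M (approx_set eps V) A w
     <= (2 * eps)%:E * mu_angle (null_space M) V)%E.
Proof.
move=> MB V0 VB eps0 AK; have eps2 : 0 < 2 * eps by rewrite mulr_gt0.
apply: nnsup_le.
  by rewrite mule_ge0 ?lee_fin ?(ltW eps2)//; exact: nnsup_ge0.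
move=> x Kx; have [KA MA] := AK _ _ Kx; have [Kx' Mx] := Kx.
apply: norm_le_mu_angle => //.
  by rewrite /null_space /= MB Mx -[in A _]Mx MA subrr.
apply: le_trans (distB_le _ _ V0 VB) _.
by rewrite mulr_natl mulr2n lerD.
Qed.

End Measurements.

Theorem theorem5p1 (R : realType) (X : completeNormedModType R)
    (V : set X) (hV : findim_subspace V)
    (eps : R) (heps : 0 < eps)
    (m : nat) (M : X -> 'rV[R]_m) (hM : measurement_operator M)
    (hN : null_space M <> [set 0])
    (hNV : null_space M `&` V = [set 0])
    (Delta : 'rV[R]_m -> X) (hDelta : lifting M Delta)
    (hDelta_fin : lifting_bounds M Delta !=set0)
    (lam : R) (hlam : 1 <= lam)
    (Lambda : 'rV[R]_m -> 'rV[R]_m)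
    (hLambda : near_best M (M @` V) lam Lambda) :
  let K := approx_set eps V in
  let A := reconstruction M V Delta Lambda in
  [/\ forall w : 'rV[R]_m, slice M [set: X] w (A w),
      forall x : X, dist (A (M x)) V <= lam * lifting_norm M Delta * dist x V
    & lifting_norm M Delta = 1 -> lam = 1 ->
      [/\ forall (w : 'rV[R]_m) (x : X),
            slice M K w x -> slice M K w (A (M x)),
          forall w : 'rV[R]_m,
            (slice_error M K A w <= 2%:E * chebyshev_rad (slice M K w))%E,
          (nnsup [set: 'rV[R]_m] (slice_error M K A) <= 2%:E * sup_rad M K)%E
        & (nnsup [set: 'rV[R]_m] (slice_error M K A)
             <= (4 * eps)%:E * mu_angle (null_space M) V)%E]].
Proof.
move=> K A.
have MB := measurement_operatorB hM.
have VB := findim_subspaceB hV.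
have V0 : V !=set0 by exists 0; exact: findim_subspace0.
have Adist x : dist (A (M x)) V <= lam * lifting_norm M Delta * dist x V.
  by apply: dist_reconstruction => //; exact: le_trans ler01 hlam.
have MA w : M (A w) = w by exact: (reconstruction_slice MB hLambda).
split=> [w||Delta1 lam1]; [by split; last exact: MA|exact: Adist|].
have AK w x : slice M K w x -> slice M K w (A (M x)).
  move=> [Kx Mx]; split; last by rewrite /= MA.
  by apply: le_trans (Adist x) _; rewrite lam1 Delta1 !mul1r.
have err_rad w := slice_error_le_rad w AK.
have mu0 : (0 <= mu_angle (null_space M) V)%E by exact: nnsup_ge0.
split=> //; apply: nnsup_le.
- by rewrite mule_ge0 ?lee_fin//; exact: nnsup_ge0.
- move=> w _; apply: le_trans (err_rad w) _; rewrite lee_wpmul2l ?lee_fin//.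
  exact: (le_nnsup (fun w => chebyshev_rad (slice M K w))).
- by rewrite mule_ge0 ?lee_fin ?mulr_ge0 ?(ltW heps).
- move=> w _; apply: le_trans (slice_error_le_mu_angle w MB V0 VB heps AK) _.
  by rewrite lee_wpmul2r// lee_fin ler_wpM2r ?(ltW heps)// ler_nat.
Qed.
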